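(* The game $\mathscr{G}$ is bound to stop at a Nash equilibrium, and has the finite improvement property. That is: every sequence of groupings $\bm{\pi}^{(0)},\bm{\pi}^{(1)},\bm{\pi}^{(2)},\dots$ in which each step is $\bm{\pi}^{(t)}\xrightarrow{\mathbb{J}^{m}}\bm{\pi}^{(t+1)}$ for an action $\mathbb{J}^m$ of some single BS $m=m_t\in\mathcal{M}$ with $\mathcal{D}_{m}(\bm{\pi}^{(t)}\xrightarrow{\mathbb{J}^{m}}\bm{\pi}^{(t+1)})<0$ is finite, and any such sequence that cannot be extended further ends at a Nash equilibrium of $\mathscr{G}$.
   Context: System: $\mathcal{M}=\{1,\dots,M\}$ base stations (BSs), $\mathcal{N}=\{1,\dots,N\}$ users, $\mathcal{G}=\{1,\dots,G\}$ channels available in every BS. Each user is associated with one fixed BS; $\mathcal{U}^m$ is the set of users of BS $m$. A grouping (subchannel assigning vector) is $\bm{\pi}=(\pi_1,\dots,\pi_N)\in\mathcal{G}^N$, $\pi_n$ being the channel of user $n$; the group $mg$ is $\mathcal{U}^{m,g}=\{n\in\mathcal{U}^m:\pi_n=g\}$. $H^{m,g}_n\ne0$ is the channel coefficient between BS $m$ and user $n$ on channel $g$, $\sigma^2>0$ the noise power, $r_n\ge0$ the target rate of user $n$. Total power of a grouping: the powers $p_n\ge0$ under $\bm{\pi}$ are the solution of $$p_n=(2^{r_n}-1)\Big(\frac{I_n+\sigma^2}{|H^{m,g}_n|^2}+\sum_{i\in\mathcal{U}^{m,g}:\,S^{m,g}_i>S^{m,g}_n}p_i\Big),\quad n\in\mathcal{U}^{m,g},$$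 where $I_n=\sum_{m'\ne m}|H^{m',g}_n|^2\sum_{j\in\mathcal{U}^{m',g}}p_j$ and $S^{m,g}_n=|H^{m,g}_n|^2/(I_n+\sigma^2)$ (ties in $S$ are broken by a fixed labelling of users, and $S_i>S_n$ means $i$ comes after $n$ in the resulting order). Such a solution is assumed to exist for every grouping. $P_{total}(\bm{\pi})=\sum_{n\in\mathcal{N}}p_n$ is the total transmit power under $\bm{\pi}$. Game $\mathscr{G}$: the players are the BSs. An action $\mathbb{J}^m$ of BS $m$ at $\bm{\pi}$ reassigns some users of BS $m$ to other channels; $\bm{\pi}\xrightarrow{\mathbb{J}^m}\bm{\pi}'$ means that $\mathbb{J}^m$ changes $\bm{\pi}$ into $\bm{\pi}'$ (so $\bm{\pi}'$ differs from $\bm{\pi}$ only in coordinates of users of BS $m$, and any such $\bm{\pi}'$ is reached by an action). The action effect function, which player $m$ aims to minimize, is $\mathcal{D}_m(\bm{\pi}\xrightarrow{\mathbb{J}^m}\bm{\pi}')=P_{total}(\bm{\pi}')-P_{total}(\bm{\pi})$. Nash equilibrium: a grouping $\bm{\pi}^*$ such that for every $m\in\mathcal{M}$ and every action $\bm{\pi}^*\xrightarrow{\mathbb{J}^m}\bm{\pi}'$ one has $\mathcal{D}_m(\bm{\pi}^*\xrightarrow{\mathbb{J}^m}\bm{\pi}')\ge0$. Finite improvement property: the game, played by successive unilateral strictly improving actions, always stops after a finite number of iterations. *)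

(* Defs.v *)
From HB Require Import structures.
From mathcomp Require Import all_boot all_order all_algebra all_fingroup.
From mathcomp Require Import complex.
From mathcomp Require Import reals exp.

Set Implicit Arguments.
Unset Strict Implicit.
Unset Printing Implicit Defensive.

Import Order.TTheory GRing.Theory Num.Theory.
Local Open Scope ring_scope.

(** * Games with actions at a profile *)

(** [action G m x y] says that player [m] has an action changing [x] into [y].
    As only the resulting profile matters for [effect], an action at [x] is
    represented by the profile it leads to. *)
Record game (R : realType) := Game {
  player : finType;
  profile : finType;
  action : player -> rel profile;
  effect : player -> profile -> profile -> R
}.

Definition is_nash (R : realType) (G : game R) (x : profile G) : Prop :=
  forall (m : player G) (y : profile G), action m x y -> 0 <= effect m x y.

(** A step in which some single player strictly decreases its effect. *)
Definition improving_step (R : realType) (G : game R) : rel (profile G) :=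
  fun x y => [exists m : player G, action m x y && (effect m x y < 0)].

Definition finite_improvement_property (R : realType) (G : game R) : Prop :=
  forall x : nat -> profile G, ~ (forall t, improving_step (x t) (x t.+1)).

(** * Multi-cell network with superposed users *)

(** [chan m g n] is the coefficient between base station [m] and user [n] on
    channel [g], for every base station and not only the one serving [n];
    [noise] is the noise power (sigma squared). *)
Record network (R : realType) (M N G : nat) := Network {
  bs_of : 'I_N -> 'I_M;
  chan : 'I_M -> 'I_G -> 'I_N -> R[i];
  noise : R;
  rate : 'I_N -> R;
  label : 'S_N;
  chan_neq0 : forall m g n, chan m g n != 0;
  noise_gt0 : 0 < noise;
  rate_ge0 : forall n, 0 <= rate n
}.

Notation grouping N G := {ffun 'I_N -> 'I_G}.

Section Network.
Context {R : realType} {M N G : nat} (net : network R M N G).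
Implicit Types (pi : grouping N G) (p : 'I_N -> R).

Definition gain (m : 'I_M) (g : 'I_G) (n : 'I_N) : R :=
  ComplexField.Normc.normc (chan net m g n) ^+ 2.

Definition users (m : 'I_M) : {set 'I_N} := [set n | bs_of net n == m].

Definition group pi (m : 'I_M) (g : 'I_G) : {set 'I_N} :=
  [set n in users m | pi n == g].

Definition interference pi p (n : 'I_N) : R :=
  \sum_(m' < M | m' != bs_of net n)
    gain m' (pi n) n * \sum_(j in group pi m' (pi n)) p j.

Definition quality pi p (n : 'I_N) : R :=
  gain (bs_of net n) (pi n) n / (interference pi p n + noise net).

Definition comes_after pi p (i n : 'I_N) : bool :=
  (quality pi p n < quality pi p i)
  || (quality pi p i == quality pi p n) && (label net n < label net i)%N.

Definition is_power_solution pi p : Prop :=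
  forall n : 'I_N, 0 <= p n /\
    p n = (2 `^ rate net n - 1) *
      ((interference pi p n + noise net) / gain (bs_of net n) (pi n) n
       + \sum_(i in group pi (bs_of net n) (pi n) | comes_after pi p i n) p i).

(** [m] may change the channels of its own users only, in any way. *)
Definition regroup (m : 'I_M) : rel (grouping N G) :=
  fun pi pi' => [forall n, (n \notin users m) ==> (pi' n == pi n)].

(** [p pi] is the power vector used under the grouping [pi]. *)
Definition total_power (p : grouping N G -> 'I_N -> R) pi : R :=
  \sum_(n < N) p pi n.

(** The effect is the same for all players: each counts the power of the whole
    network, not only that of its own cell. *)
Definition grouping_game (p : grouping N G -> 'I_N -> R) : game R :=
  Game regroup
    (fun (m : 'I_M) pi pi' => total_power p pi' - total_power p pi).

End Network.

(* Main.v *)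
(** The common effect of all the players is the variation of one real function,
    the total power, so this function is a potential: it strictly decreases along
    improving steps, and a sequence of improving steps never repeats one of the
    finitely many groupings. *)
Require Import Defs.
From mathcomp Require Import all_boot all_order all_algebra.
From mathcomp Require Import reals.
Local Open Scope ring_scope.

Import Order.TTheory GRing.Theory Num.Theory.

(** A strictly decreasing [f \o x] is injective, hence so is [x], which the finiteness of [T]
    forbids. *)
Lemma no_infinite_descent (d : Order.disp_t) (S : orderType d) (T : finType)
    (f : T -> S) (x : nat -> T) :
  ~ (forall t, (f (x t.+1) < f (x t))%O).
Proof.
move=> fx_dec.
have /dec_inj fx_inj := Order.NatMonotonyTheory.decnP (f := f \o x) fx_dec.
(* Pigeonhole: one more index than [T] has elements. *)
have /leq_card : injective (fun i : 'I_#|T|.+1 => x i).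
  by move=> i j xij; apply/val_inj/fx_inj; rewrite /= xij.
by rewrite card_ord ltnn.
Qed.

(** An exact potential in the sense of Monderer and Shapley, [effect] being the change in a player's
    cost, but asked of all pairs of profiles. *)
Definition exact_potential {R : realType} (G : game R) (f : profile G -> R) :=
  forall (m : player G) (x y : profile G), effect m x y = f y - f x.

Lemma potential_finite_improvement {R : realType} (G : game R)
    (f : profile G -> R) :
  exact_potential G f -> finite_improvement_property G.
Proof.
move=> potf x improving; apply: (@no_infinite_descent _ R _ f x) => t.
by have /existsP[m /andP[_]] := improving t; rewrite potf subr_lt0.
Qed.

Lemma no_improving_step_nash {R : realType} (G : game R) (x : profile G) :
  (forall y : profile G, ~~ improving_step x y) -> is_nash x.
Proof.
move=> stuck m y mxy; rewrite leNgt; apply: contraNN (stuck y) => effect_lt0.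
by apply/existsP; exists m; rewrite mxy.
Qed.

Theorem corollary1 (R : realType) (M N G : nat) (net : network R M N G)
    (p : grouping N G -> 'I_N -> R)
    (p_solution : forall pi : grouping N G, is_power_solution net pi (p pi)) :
  finite_improvement_property (grouping_game net p) /\
  (forall (pi : grouping N G) (s : seq (grouping N G)),
     path (@improving_step R (grouping_game net p)) pi s ->
     (forall pi' : grouping N G,
        ~~ @improving_step R (grouping_game net p) (last pi s) pi') ->
     @is_nash R (grouping_game net p) (last pi s)).
Proof.
split; last by move=> pi s _; exact: (@no_improving_step_nash _ (grouping_game net p)).
(* The remaining [exact_potential] goal holds by unfolding [effect]. *)
by exact: (@potential_finite_improvement _ (grouping_game net p) (total_power p)).
Qed.
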